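(* Let $K$ be a field of characteristic zero and, for $n\ge 13$, let $\mathfrak{f}_n$ be the $n$-dimensional filiform nilpotent Lie algebra over $K$ defined in the context. Then $\mathrm{Der}(\mathfrak{f}_n)=\mathrm{AID}(\mathfrak{f}_n)$ for all $n\ge 13$.
   Context: For a finite-dimensional Lie algebra $\mathfrak{g}$, $\mathrm{Der}(\mathfrak{g})$ is its Lie algebra of derivations. A derivation $D$ is almost inner if $D(x)\in[\mathfrak{g},x]=\{[y,x]\mid y\in\mathfrak{g}\}$ for all $x\in\mathfrak{g}$, and $\mathrm{AID}(\mathfrak{g})$ is the space of almost inner derivations. Definition of $\mathfrak{f}_n$ ($n\ge 13$): it has basis $e_1,\dots,e_n$ and Lie brackets (extended by bilinearity and antisymmetry; it is known that this defines a filiform nilpotent Lie algebra) $$[e_1,e_i]=e_{i+1},\quad 2\le i\le n-1,\qquad [e_1,e_n]=0,$$ $$[e_i,e_j]=\sum_{r=1}^n\Bigl(\sum_{\ell=0}^{\lfloor (j-i-1)/2\rfloor}(-1)^\ell\binom{j-i-\ell-1}{\ell}\alpha_{i+\ell,\,r-j+i+2\ell+1}\Bigr)e_r,\quad 2\le i<j\le n,$$ where the parameters $\alpha_{k,s}$ are all zero (including when an index is outside $\{1,\dots,n\}$) except for $$\alpha_{\ell,2\ell+1}=\frac{3}{\binom{\ell}{2}\binom{2\ell-1}{\ell-1}},\quad \ell=2,3,\dots,\Bigl\lfloor\frac{n-1}{2}\Bigr\rfloor,$$ $$\alpha_{3,n-4}=1,\qquad \alpha_{4,n-2}=\frac17+\frac{10}{21}\frac{(n-7)(n-8)}{(n-4)(n-5)},$$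 $$\alpha_{4,n}=\frac{22105}{15246}\ \text{ if } n=13,\qquad \alpha_{4,n}=0\ \text{ if } n\ge 14,$$ $$\alpha_{5,n}=\frac1{42}-\frac{70(n-8)}{11(n-2)(n-3)(n-4)(n-5)}+\frac{25}{99}\frac{(n-6)(n-7)(n-8)}{(n-2)(n-3)(n-4)}+\frac5{66}\frac{(n-5)(n-6)}{(n-2)(n-3)}-\frac{65}{1386}\frac{(n-7)(n-8)}{(n-4)(n-5)}.$$ *)

(* Defs.v *)
From mathcomp Require Import all_boot all_order all_algebra.
From mathcomp Require Import boolp classical_sets.

Set Implicit Arguments.
Unset Strict Implicit.
Unset Printing Implicit Defensive.

Import GRing.Theory.
Local Open Scope ring_scope.

Section Derivations.
Variables (K : fieldType) (V : vectType K) (lie : V -> V -> V).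

Definition is_derivation (D : 'End(V)) : Prop :=
  forall x y, D (lie x y) = lie (D x) y + lie x (D y).

(* [D x] lies in [[V, x]], the set of all brackets [[y, x]]. *)
Definition is_almost_inner (D : 'End(V)) : Prop :=
  forall x, exists y, D x = lie y x.

Definition Der : set 'End(V) := [set D | is_derivation D]%classic.

Definition AID : set 'End(V) :=
  [set D | is_derivation D /\ is_almost_inner D]%classic.

End Derivations.

Section Filiform.
Variables (K : fieldType) (n : nat).

Let N : K := n%:R.

(* Indices are 1-based, as in e_1, ..., e_n.  For n >= 13 the cases below are
   mutually exclusive, so the order of the tests is immaterial. *)
Definition alpha (k s : nat) : K :=
  if ~~ [&& 1 <= k <= n & 1 <= s <= n]%N then 0
  else if (2 <= k <= (n - 1) %/ 2)%N && (s == 2 * k + 1)%N then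
    3 / ('C(k, 2)%:R * 'C(2 * k - 1, k - 1)%:R)
  else if (k == 3)%N && (s == n - 4)%N then 1
  else if (k == 4)%N && (s == n - 2)%N then
    1 / 7 + 10 / 21 * (((N - 7) * (N - 8)) / ((N - 4) * (N - 5)))
  else if (k == 4)%N && (s == n)%N then
    if (n == 13)%N then 22105 / 15246 else 0
  else if (k == 5)%N && (s == n)%N then
    1 / 42
    - (70 * (N - 8)) / (11 * (N - 2) * (N - 3) * (N - 4) * (N - 5))
    + 25 / 99 * (((N - 6) * (N - 7) * (N - 8))
                 / ((N - 2) * (N - 3) * (N - 4)))
    + 5 / 66 * (((N - 5) * (N - 6)) / ((N - 2) * (N - 3)))
    - 65 / 1386 * (((N - 7) * (N - 8)) / ((N - 4) * (N - 5)))
  else 0.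

(* Coefficient of e_r in [e_i, e_j], for 2 <= i < j <= n.  The second index
   r - j + i + 2l + 1 of alpha may be negative; truncated subtraction then
   yields 0, which is also out of range, so alpha vanishes as it should. *)
Definition fili_coef (i j r : nat) : K :=
  \sum_(0 <= l < ((j - i - 1) %/ 2).+1)
    (-1) ^+ l * 'C(j - i - l - 1, l)%:R
    * alpha (i + l) (r + i + 2 * l + 1 - j).

(* The basis vector e_k for 1 <= k <= n, and 0 for other k; in particular
   e_(n+1) = 0. *)
Definition fili_basis (k : nat) : 'rV[K]_n := \row_(m < n) (m.+1 == k)%:R.

(* [e_i, e_j] for 1 <= i < j <= n *)
Definition fili_lie_lt (i j : nat) : 'rV[K]_n :=
  if (i == 1)%N then fili_basis j.+1
  else \sum_(1 <= r < n.+1) fili_coef i j r *: fili_basis r.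

Definition fili_lie_basis (i j : nat) : 'rV[K]_n :=
  if (i < j)%N then fili_lie_lt i j
  else if (j < i)%N then - fili_lie_lt j i
  else 0.

(* The coordinate [x 0 i] belongs to e_(i+1). *)
Definition fili_lie (x y : 'rV[K]_n) : 'rV[K]_n :=
  \sum_(i < n) \sum_(j < n) (x 0 i * y 0 j) *: fili_lie_basis i.+1 j.+1.

End Filiform.

Arguments alpha : clear implicits.
Arguments fili_coef : clear implicits.
Arguments fili_basis : clear implicits.
Arguments fili_lie_lt : clear implicits.
Arguments fili_lie_basis : clear implicits.
Arguments fili_lie : clear implicits.

(* Main.v *)
Require Import Defs.
From HB Require Import structures.
From mathcomp Require Import all_boot all_order all_algebra.
From mathcomp Require Import zify ring.
From mathcomp Require Import boolp classical_sets.

Import GRing.Theory.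
Local Open Scope ring_scope.

(** Give e_i the weight i and put d = n - 11 >= 2.  The parameters
    alpha_(k,2k+1) make f_n a filtered deformation of a truncated Witt algebra:
    for i, j >= 2,
      [e_i, e_j] = c_ij e_(i+j) + g_ij e_(i+j+d) + h_ij e_(i+j+2d)  (lie_ge2),
    where c_ij = 6 (i-2)! (j-2)! (j-i) / (i+j-2)! vanishes only for i = j.  The
    perturbation g matters only for i + j <= 11, and h only for n = 13 and
    i + j = 9.  The alternating binomial sums of the definition are evaluated by
    the recurrence [e_i, e_(j+1)] = [e_1, [e_i, e_j]] - [e_(i+1), e_j], which is
    Pascal's rule.  The Jacobi identity (lie_jacobi) follows: it holds in weight
    i + j + k because it does in the Witt algebra, and for weight reasons only
    four triples of indices >= 2 remain to be checked in the weights above.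
    It is needed because it makes inner derivations derivations.

    Let D be a derivation.  Subtracting ad y for a suitable y
    (derivation_reduction), one may assume
      D e_1 = l e_1 + a e_2,  D e_2 = b e_1 + u e_2 + v,  v in <e_4, ..., e_n>.
    Evaluating D e_5 through e_5 = [e_1, e_4] and through e_5 = [e_2, e_3] gives
    b = a = 0 and u = 2l in weights 4, 5, 6 (derivation_low_terms).  In weight
    m + 3 it gives c (1 - c_(m,3) - c_(2,m+1)) = 0 for a leading term c e_m of v,
    and this forces v in <e_(n-2), e_(n-1), e_n> (derivation_high_terms).  Then D
    is l times the grading derivation plus a map that raises weights by at
    least n - 4.  Applied to [e_3, e_4] = e_7 / 10 + e_(n-4), it yields
    (n - 11) l = 0, so l = 0 (derivation_no_grading).

    What is left raises weights by at least n - 4 and vanishes on e_1 and on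
    <e_5, ..., e_n>.  For x with leading vector e_i, the set [g, x] contains all
    vectors of weight greater than 2i (lie_onto), because c_(m-i,i) is nonzero
    for m > 2i; so D x lies in [g, x] (high_almost_inner).  Adding back ad y
    preserves this property. *)

(** * Structure constants of the Witt algebra *)

Section Witt.
Variables (K : fieldType) (charK0 : [pchar K] =i pred0).

Lemma natK_eq0 m : (m%:R == 0 :> K) = (m == 0)%N.
Proof. by move/pcharf0P: charK0 => ->. Qed.

Lemma natD_neq0 m k : m%:R + k.+1%:R != 0 :> K.
Proof. by rewrite -natrD natK_eq0 addnS. Qed.

(** The factorial is wrapped so that ring and field treat it as an atom instead
    of unfolding it. *)
Definition kfact (m : nat) : K := m`!%:R.

Lemma kfactS m : kfact m.+1 = (m%:R + 1) * kfact m.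
Proof. by rewrite /kfact factS natrM natr1. Qed.

Lemma kfact_neq0 m : kfact m != 0.
Proof. by rewrite natK_eq0 -lt0n fact_gt0. Qed.

Lemma natB_neq0 i j : i != j -> j%:R - i%:R != 0 :> K.
Proof.
by case: (ltngtP i j) => // ij _; last rewrite -opprB oppr_eq0;
  rewrite -natrB ?natK_eq0 1?ltnW // -lt0n subn_gt0.
Qed.

(** In the Witt algebra, with basis E_m and [E_i, E_j] = (j - i) E_(i+j), put
    e_1 = E_1 and e_m = 6 (m-2)! E_m for m >= 2.  Then [e_1, e_m] = e_(m+1), and
    for i, j >= 2 the coefficient of e_(i+j) in [e_i, e_j] is the number below. *)
Definition witt (i j : nat) : K :=
  6 * kfact (i - 2) * kfact (j - 2) * (j%:R - i%:R) / kfact (i + j - 2).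

Lemma wittE i j :
  witt i.+2 j.+2 = 6 * kfact i * kfact j * (j%:R - i%:R) / kfact (i + j).+2.
Proof.
rewrite /witt; have -> : (i.+2 + j.+2 - 2 = (i + j).+2)%N by lia.
rewrite !subn2 /= -(addn2 i) -(addn2 j) !natrD; congr (_ / _).
by congr (_ * _); ring.
Qed.

Lemma witt_anti i j : witt i j = - witt j i.
Proof.
rewrite /witt (addnC j) -opprB mulrN mulNr -!mulrA.
by rewrite [kfact _ * (kfact _ * _)]mulrCA.
Qed.

Lemma witt_neq0 i j : i != j -> witt i j != 0.
Proof.
move=> ij.
by rewrite /witt !mulf_neq0 ?invr_eq0 ?kfact_neq0 ?natK_eq0 ?natB_neq0.
Qed.

(** This says that ad E_1 is a derivation of the Witt algebra. *)
Lemma wittS i j : (2 <= i)%N -> (2 <= j)%N ->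
  witt i j.+1 = witt i j - witt i.+1 j.
Proof.
case: i => [|[|i]] // _; case: j => [|[|j]] // _.
rewrite !wittE addSn addnS (kfactS (i + j).+2) (kfactS i) (kfactS j).
have := natD_neq0 (i + j) 2; have := kfact_neq0 (i + j).+2.
rewrite -(natr1 i) -(natr1 j) -(addn2 (i + j)) !natrD.
move: (kfact _) (kfact _) (kfact _) (i%:R) (j%:R) => f1 f2 f3 x y h1.
have -> : x + y + 3 = x + y + 2 + 1 by ring.
by move=> h2; field; rewrite h1 h2.
Qed.

Lemma witt_jacobi i j k : (2 <= i)%N -> (2 <= j)%N -> (2 <= k)%N ->
  witt i j * witt (i + j) k + witt j k * witt (j + k) i
  + witt k i * witt (k + i) j = 0.
Proof.
case: i => [|[|i]] // _; case: j => [|[|j]] // _; case: k => [|[|k]] // _.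
have E a b : (a.+2 + b.+2 = (a + b).+4)%N by lia.
rewrite !E !wittE.
have -> : ((j + k).+2 + i = (i + j).+2 + k)%N by lia.
have -> : ((k + i).+2 + j = (i + j).+2 + k)%N by lia.
have := kfact_neq0 (i + j).+2; have := kfact_neq0 (j + k).+2.
have := kfact_neq0 (k + i).+2; have := kfact_neq0 ((i + j).+2 + k).+2.
move: (kfact (i + j).+2) (kfact (j + k).+2) (kfact (k + i).+2) (kfact _.+2).
move: (kfact i) (kfact j) (kfact k) => f1 f2 f3 f4 f5 f6 f7 h1 h2 h3 h4.
rewrite -(addn2 (i + j)) -(addn2 (j + k)) -(addn2 (k + i)) !natrD.
move: (i%:R) (j%:R) (k%:R) => x y z.
by field; rewrite h1 h2 h3 h4.
Qed.

(** The parameter alpha_(k,2k+1) is the Witt constant of [e_k, e_(k+1)]; this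
    is what makes f_n a deformation of a truncated Witt algebra. *)
Lemma witt_diag k : (2 <= k)%N ->
  witt k k.+1 = 3 / ('C(k, 2)%:R * 'C(2 * k - 1, k - 1)%:R).
Proof.
case: k => [|[|k]] // _; rewrite wittE.
have -> : (2 * k.+2 - 1 = (k + k.+1).+2)%N by lia.
rewrite subSS subn0.
have b1 : 2 * 'C(k.+2, 2)%:R = k.+2%:R * k.+1%:R :> K.
  by rewrite -!natrM -(mul_bin_diag k.+2 1) bin1.
have b2 : 'C((k + k.+1).+2, k.+1)%:R * (kfact k.+1 * kfact k.+2)
    = kfact (k + k.+1).+2.
  rewrite /kfact -!natrM -(@bin_fact (k + k.+1).+2 k.+1); last by lia.
  by have -> : ((k + k.+1).+2 - k.+1 = k.+2)%N by lia.
have h1 : 'C(k.+2, 2)%:R != 0 :> K by rewrite natK_eq0 -lt0n bin_gt0.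
have h2 : 'C((k + k.+1).+2, k.+1)%:R != 0 :> K.
  by rewrite natK_eq0 -lt0n bin_gt0; lia.
have h4 : k.+1%:R != 0 :> K by rewrite natK_eq0.
have h5 : k.+2%:R != 0 :> K by rewrite natK_eq0.
rewrite -b2 (kfactS k.+1) (kfactS k) !natr1.
have h3 := kfact_neq0 k.
have -> : k.+1%:R - k%:R = 1 :> K by rewrite -natr1 addrC addKr.
apply: (mulIf (mulf_neq0 h1 h2)); rewrite divfK ?mulf_neq0 //.
have t0 : 2 != 0 :> K by rewrite natK_eq0.
have -> : 'C(k.+2, 2)%:R = k.+2%:R * k.+1%:R / 2 :> K by rewrite -b1 mulrC mulKf.
move: h2 h3 h4 h5; move: ('C(_, k.+1)%:R) (kfact _) (k.+1%:R) (k.+2%:R).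
by move=> c f a b h2 h3 h4 h5; field; rewrite t0 h2 h3 h4 h5.
Qed.

(** When one index is a small number the quotient of factorials becomes a
    rational function of the other index; the finitely many Jacobi identities
    checked below live on these values. *)
Lemma witt_r2 m : witt m.+2 2 = - 6 * m%:R / ((m%:R + 1) * (m%:R + 2)).
Proof.
rewrite wittE // addn0 !kfactS; have -> : kfact 0 = 1 by [].
have := kfact_neq0 m.
have := natD_neq0 m 0; have := natD_neq0 m 1.
rewrite -(natr1 m); move: (kfact _) (m%:R) => f x h2 h1 h0.
have e : x + 2 = x + 1 + 1 by ring.
by rewrite e in h2 *; field; rewrite h0 h1 h2.
Qed.

Lemma witt_r3 m :
  witt m.+2 3 = 6 * (1 - m%:R) / ((m%:R + 1) * (m%:R + 2) * (m%:R + 3)).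
Proof.
rewrite wittE // addn1 !kfactS; have -> : kfact 0 = 1 by [].
have := kfact_neq0 m.
have := natD_neq0 m 0; have := natD_neq0 m 1.
have := natD_neq0 m 2.
rewrite -(natr1 m.+1) -(natr1 m); move: (kfact _) (m%:R) => f x h3 h2 h1 h0.
have e3 : x + 3 = x + 1 + 1 + 1 by ring.
have e : x + 2 = x + 1 + 1 by ring.
by rewrite ?e3 ?e in h2 h3 *; field; rewrite h0 h1 h2 h3.
Qed.

Lemma witt_r4 m : witt m.+2 4 =
  12 * (2 - m%:R) / ((m%:R + 1) * (m%:R + 2) * (m%:R + 3) * (m%:R + 4)).
Proof.
rewrite wittE // addn2 !kfactS; have -> : kfact 0 = 1 by [].
have := kfact_neq0 m.
have := natD_neq0 m 0; have := natD_neq0 m 1.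
have := natD_neq0 m 2; have := natD_neq0 m 3.
rewrite -(natr1 m.+2) -(natr1 m.+1) -(natr1 m).
move: (kfact _) (m%:R) => f x h4 h3 h2 h1 h0.
have e4 : x + 4 = x + 1 + 1 + 1 + 1 by ring.
have e3 : x + 3 = x + 1 + 1 + 1 by ring.
have e : x + 2 = x + 1 + 1 by ring.
by rewrite ?e4 ?e3 ?e in h2 h3 h4 *; field; rewrite h0 h1 h2 h3 h4.
Qed.

Lemma witt_small : ((witt 2 3 = 1) * (witt 3 4 = 1 / 10) * (witt 3 5 = 1 / 10)
  * (witt 3 6 = 3 / 35) * (witt 4 5 = 1 / 70) * (witt 2 4 = 1) * (witt 4 2 = - 1)
  * (witt 5 2 = - 9 / 10) * (witt 6 2 = - 4 / 5))%type.
Proof.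
rewrite (witt_anti 3 5) (witt_anti 3 6) (witt_anti 4 5).
rewrite !(witt_r2, witt_r3, witt_r4).
by do !split; field; rewrite -?natrD ?natK_eq0.
Qed.

(** The degree-(m - 2) shift e_i |-> e_(i+m-2), i >= 2, kills e_1 and respects
    [e_2, e_3] = e_5 only if this quantity vanishes.  With k = m - 2 its
    numerator is k^3 + 5k - 6 = (k - 1)(k^2 + k + 6), whose only natural root
    k = 1 belongs to ad e_1. *)
Lemma witt_shift23_neq0 m : (4 <= m)%N -> 1 - witt m 3 - witt 2 m.+1 != 0.
Proof.
case: m => [|[|[|[|k]]]] // _; rewrite (witt_anti 2) opprK witt_r2 witt_r3.
rewrite -(natr1 k.+2) -(natr1 k.+1) -(natr1 k).
have hx c : k%:R + c.+1%:R != 0 :> K by apply: natD_neq0.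
have hq : (k%:R + 2) * (k%:R + 2) + (k%:R + 8) != 0 :> K.
  by rewrite -!natrD -natrM -natrD natK_eq0 addnA addnS.
have h1 : k%:R + 1 != 0 :> K by rewrite natr1 natK_eq0.
move: (k%:R) h1 hx hq => x h1 hx hq.
(* here m = x + 4, so the degree of the shift is x + 2 *)
have -> : 1 - 6 * (1 - (x + 1 + 1))
     / ((x + 1 + 1 + 1) * (x + 1 + 1 + 2) * (x + 1 + 1 + 3))
   + - 6 * (x + 1 + 1 + 1) / ((x + 1 + 1 + 1 + 1) * (x + 1 + 1 + 1 + 2))
 = (x + 1) * ((x + 2) * (x + 2) + (x + 8)) / ((x + 3) * (x + 4) * (x + 5)).
  by field; rewrite !hx.
by rewrite !mulf_neq0 ?invr_eq0 ?mulf_neq0 ?hx.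
Qed.

End Witt.

(** * Brackets of basis vectors *)

Section Pert.
Variables (K : fieldType) (charK0 : [pchar K] =i pred0).
Variables (n : nat) (n_ge13 : (13 <= n)%N).

Let N : K := n%:R.
(* the degree of the perturbation: alpha_(3,n-4), alpha_(4,n-2) and alpha_(5,n)
   all shift the Witt weight by n - 11 *)
Let d := (n - 11)%N.

(** The parameters alpha_(4,n-2), alpha_(5,n) and alpha_(4,n). *)
Definition pertA : K :=
  1 / 7 + 10 / 21 * (((N - 7) * (N - 8)) / ((N - 4) * (N - 5))).

Definition pertB : K :=
  1 / 42
  - (70 * (N - 8)) / (11 * (N - 2) * (N - 3) * (N - 4) * (N - 5))
  + 25 / 99 * (((N - 6) * (N - 7) * (N - 8))
               / ((N - 2) * (N - 3) * (N - 4)))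
  + 5 / 66 * (((N - 5) * (N - 6)) / ((N - 2) * (N - 3)))
  - 65 / 1386 * (((N - 7) * (N - 8)) / ((N - 4) * (N - 5))).

Definition pertH : K := if (n == 13)%N then 22105 / 15246 else 0.

(** The coefficient of e_(i+j+d) in [e_i, e_j] for i < j and i + j <= 11; when
    i + j > 11 that basis vector is zero, so the default value is harmless.
    The entries follow from those at (k, k+1) by the recurrence expressing that
    ad e_1 is a derivation. *)
Definition pert1_lt (i j : nat) : K :=
  match i, j with
  | 3, 4 => 1 | 2, 5 => - 1
  | 3, 5 => 1 | 2, 6 => - 2
  | 4, 5 => pertA | 3, 6 => 1 - pertA | 2, 7 => pertA - 3
  | 4, 6 => pertA | 3, 7 => 1 - 2 * pertA | 2, 8 => 3 * pertA - 4
  | 5, 6 => pertB | 4, 7 => pertA - pertB | 3, 8 => 1 - 3 * pertA + pertB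
  | 2, 9 => 6 * pertA - 5 - pertB
  | _, _ => 0
  end.

(** The coefficient of e_(i+j+2d), where d = n - 11: only n = 13 leaves room for
    it, and then i + j = 9 is the only nonzero diagonal. *)
Definition pert2_lt (i j : nat) : K :=
  match i, j with
  | 4, 5 => pertH | 3, 6 => - pertH | 2, 7 => pertH
  | _, _ => 0
  end.

Definition pert1 i j := pert1_lt i j - pert1_lt j i.
Definition pert2 i j := pert2_lt i j - pert2_lt j i.

Lemma pert1_anti i j : pert1 i j = - pert1 j i.
Proof. by rewrite /pert1 opprB. Qed.

Lemma pert2_anti i j : pert2 i j = - pert2 j i.
Proof. by rewrite /pert2 opprB. Qed.

Lemma pert2_0 i j : n != 13%N -> pert2 i j = 0.
Proof.
move=> n13; have lt0 a b : pert2_lt a b = 0.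
  rewrite /pert2_lt /pertH (negPf n13).
  by case: a => [|[|[|[|[|a]]]]] //;
    case: b => [|[|[|[|[|[|[|[|b]]]]]]]] //; rewrite oppr0.
by rewrite /pert2 !lt0 subr0.
Qed.

Lemma pert1S i j : (2 <= i < j)%N -> (i + j <= 10)%N ->
  pert1 i j.+1 = pert1 i j - pert1 i.+1 j.
Proof.
case: i => [|[|[|[|[|i]]]]] //; last by lia.
all: case: j => [|[|[|[|[|[|[|[|[|j]]]]]]]]] //; try (move=> *; lia); move=> _ _.
all: rewrite /pert1 /=; ring.
Qed.

Lemma pert2S i j : (2 <= i < j)%N -> (i + j <= 8)%N ->
  pert2 i j.+1 = pert2 i j - pert2 i.+1 j.
Proof.
case: i => [|[|[|[|i]]]] //; last by lia.
all: case: j => [|[|[|[|[|[|[|j]]]]]]] //; try (move=> *; lia); move=> _ _.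
all: rewrite /pert2 /=; ring.
Qed.

(** The coefficient of e_r in [e_i, e_j], split by degree r - i - j. *)
Definition bracket_coef (i j r : nat) : K :=
  (r == i + j)%N%:R * witt K i j + (r == i + j + d)%N%:R * pert1 i j
  + (r == i + j + 2 * d)%N%:R * pert2 i j.

Lemma bracket_coef_anti i j r : bracket_coef i j r = - bracket_coef j i r.
Proof.
rewrite /bracket_coef witt_anti pert1_anti pert2_anti !mulrN -!opprD.
by rewrite (addnC j).
Qed.

Lemma bracket_coef_diag i r : bracket_coef i i r = 0.
Proof.
apply/eqP; have /eqP := bracket_coef_anti i i r; rewrite -subr_eq0 opprK -mulr2n.
by rewrite -mulr_natl mulf_eq0 natK_eq0.
Qed.

Lemma bracket_coefS i j r : (2 <= i < j)%N -> (r < n)%N ->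
  bracket_coef i j.+1 r.+1 = bracket_coef i j r - bracket_coef i.+1 j r.+1.
Proof.
move=> ij rn; rewrite /bracket_coef !addnS !addSn !eqSS wittS //; [|lia..].
have h1 : (r == i + j + d)%N%:R * pert1 i j.+1 =
          (r == i + j + d)%N%:R * (pert1 i j - pert1 i.+1 j).
  by case: eqP => e; rewrite ?mul0r ?pert1S //; lia.
have h2 : (r == i + j + 2 * d)%N%:R * pert2 i j.+1 =
          (r == i + j + 2 * d)%N%:R * (pert2 i j - pert2 i.+1 j).
  have [n13|n13] := eqVneq n 13%N; last by rewrite !pert2_0 ?subr0.
  by case: eqP => e; rewrite ?mul0r ?pert2S //; lia.
by rewrite h1 h2; ring.
Qed.

(** The parameters are the brackets of neighbours: alpha_(k,r) is the
    coefficient of e_r in [e_k, e_(k+1)], so this is the base case of the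
    computation of all brackets. *)
Lemma alphaE k r : (2 <= k)%N -> (r <= n)%N ->
  alpha K n k r = bracket_coef k k.+1 r.
Proof.
move=> k2 rn; rewrite /bracket_coef /alpha.
have [e0|e0] := eqVneq r (k + k.+1)%N.
  rewrite ifF ?ifT; [|lia..].
  rewrite -witt_diag // mul1r.
  have -> : (r == k + k.+1 + d)%N = false by lia.
  have -> : (r == k + k.+1 + 2 * d)%N = false by lia.
  by rewrite !mul0r !addr0.
rewrite mul0r add0r.
have [e1|e1] := eqVneq r (k + k.+1 + d)%N.
  have -> : (r == k + k.+1 + 2 * d)%N = false by lia.
  rewrite mul0r addr0 ifF; last by lia.
  have : (k <= 5)%N by lia.
  case: k k2 e0 e1 => [|[|[|[|[|[|k]]]]]] // _ e0 e1 _;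
    rewrite /pert1 /= subr0 [RHS]mul1r.
  - by rewrite ifF //; lia.
  - by rewrite ifF ?ifT //; lia.
  - by rewrite ifF ?ifT //; lia.
  - by rewrite ifF ?ifT //; lia.
rewrite mul0r add0r.
have [e2|e2] := eqVneq r (k + k.+1 + 2 * d)%N.
  rewrite ifF; last by lia.
  have : (k <= 4)%N by lia.
  case: k k2 e0 e1 e2 => [|[|[|[|[|k]]]]] // _ e0 e1 e2 _;
    rewrite /pert2 /= subr0 [RHS]mul1r.
  - by rewrite ifF //; lia.
  - by rewrite !ifF //; lia.
  - rewrite ifF; last by lia.
    rewrite ifF; last by lia.
    by rewrite ifT //; lia.
rewrite mul0r; case: ifP => // hr.
rewrite ifF; last by lia.
rewrite ifF; last by lia.
rewrite ifF; last by lia.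
case: ifP => [|_]; first by case: ifP => //; lia.
rewrite ifF //; lia.
Qed.

(** The binomial coefficients vanish beyond the upper limit of the sum, so sums
    for different pairs (i, j) can be given the same range. *)
Lemma fili_coef_widen i j r M : (j <= M)%N ->
  fili_coef K n i j r = \sum_(0 <= l < M.+1)
    (-1) ^+ l * 'C(j - i - l - 1, l)%:R
    * alpha K n (i + l) (r + i + 2 * l + 1 - j).
Proof.
move=> jM; rewrite /fili_coef.
rewrite [RHS](big_cat_nat _ (n := ((j - i - 1) %/ 2).+1)) //=; last by lia.
rewrite [X in _ = _ + X]big_nat_cond [X in _ = _ + X]big1 ?addr0 //.
move=> l /andP[/andP[hl _] _]; rewrite bin_small ?mulr0 ?mul0r //; lia.
Qed.

Lemma fili_coef_next i r : fili_coef K n i i.+1 r = alpha K n i r.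
Proof.
rewrite /fili_coef subSnn subnn div0n big_nat1 expr0 bin0 !mul1r addn0.
by congr (alpha K n _ _); lia.
Qed.

(** Pascal's rule for the binomial coefficients says that ad e_1 acts as a
    derivation.  For j = i + 1 the formula would not give [e_j, e_j] = 0, hence
    the case distinction. *)
Lemma fili_coefS i j r : (i < j)%N ->
  fili_coef K n i j.+1 r.+1 =
    fili_coef K n i j r - (if (i.+1 < j)%N then fili_coef K n i.+1 j r.+1 else 0).
Proof.
move=> ij; case: ifP => [ij1|ij1]; last first.
  have -> : j = i.+1 by lia.
  rewrite fili_coef_next subr0 /fili_coef.
  have -> : ((i.+2 - i - 1) %/ 2).+1 = 1 by lia.
  rewrite big_nat1 expr0 bin0 !mul1r addn0; congr (alpha K n _ _); lia.
rewrite (fili_coef_widen i j.+1 r.+1 j.+2) // (fili_coef_widen i j r j.+2); last by lia.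
rewrite (fili_coef_widen i.+1 j r.+1 j.+1) //.
rewrite big_nat_recl // [X in _ = X - _]big_nat_recl //.
rewrite !expr0 !bin0 !mul1r -addrA; congr (_ + _).
rewrite -sumrB; apply: eq_bigr => l _.
have -> : (i.+1 + l = i + l.+1)%N by lia.
have -> : (r.+1 + i + 2 * l.+1 + 1 - j.+1 = r + i + 2 * l.+1 + 1 - j)%N by lia.
have -> : (r.+1 + i.+1 + 2 * l + 1 - j = r + i + 2 * l.+1 + 1 - j)%N by lia.
have -> : 'C(j.+1 - i - l.+1 - 1, l.+1)
    = ('C(j - i - l.+1 - 1, l.+1) + 'C(j - i.+1 - l - 1, l))%N.
  have [hl|hl] := leqP (j - i - 1) l.
    by rewrite !bin_small //; lia.
  have -> : (j.+1 - i - l.+1 - 1 = (j - i - l.+1 - 1).+1)%N by lia.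
  by rewrite binS; congr (_ + 'C(_, _))%N; lia.
rewrite natrD exprS; ring.
Qed.

(** Both sides satisfy the recurrence that computes [e_i, e_(j+1)] from
    [e_i, e_j] and [e_(i+1), e_j], and they agree when j = i + 1. *)
Lemma fili_coefE i j r : (2 <= i < j)%N -> (r <= n)%N ->
  fili_coef K n i j r = bracket_coef i j r.
Proof.
move=> /andP[i2 ij]; have [m] := ubnP (j - i); elim: m => // m IHm in i j r i2 ij *.
case: j ij => // j; rewrite ltnS leq_eqVlt => /predU1P[<-|ij] jm rn.
  by rewrite fili_coef_next alphaE.
case: r rn => [|r] rn.
  have -> : bracket_coef i j.+1 0 = 0.
    rewrite /bracket_coef.
    have -> : (0 == i + j.+1)%N = false by lia.
    have -> : (0 == i + j.+1 + d)%N = false by lia.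
    have -> : (0 == i + j.+1 + 2 * d)%N = false by lia.
    by rewrite !mul0r !addr0.
  rewrite /fili_coef big1_seq // => l; rewrite mem_index_iota => hl.
  rewrite alphaE; [|lia..]; rewrite /bracket_coef.
  set s := (0 + i + 2 * l + 1 - j.+1)%N.
  have -> : (s == i + l + (i + l).+1)%N = false by rewrite /s; lia.
  have -> : (s == i + l + (i + l).+1 + d)%N = false by rewrite /s; lia.
  have -> : (s == i + l + (i + l).+1 + 2 * d)%N = false by rewrite /s; lia.
  by rewrite !mul0r !addr0 mulr0.
rewrite fili_coefS // bracket_coefS ?i2 // IHm //; [|lia..]; congr (_ - _).
case: ifP => ij1; first by rewrite IHm //; lia.
have -> : j = i.+1 by lia.
by rewrite bracket_coef_diag.
Qed.
End Pert.

(** * Coordinates and bilinearity *)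

Section Coord.
Variables (K : fieldType) (n : nat).
Notation E := (fili_basis K n).
Notation br := (fili_lie K n).

(** The coefficient of e_a.  Indexing by arbitrary naturals, with value 0
    outside 1..n, spares all casts between ordinals. *)
Definition crd (a : nat) (x : 'rV[K]_n) : K :=
  \sum_(m < n) x 0 m * (m.+1 == a)%:R.

Lemma crd_linear a : linear_for *%R (crd a).
Proof.
move=> c x y; rewrite /crd mulr_sumr -big_split /=; apply: eq_bigr => m _.
by rewrite !mxE mulrDl mulrA.
Qed.
HB.instance Definition _ a :=
  GRing.isLinear.Build K 'rV[K]_n K *%R (crd a) (crd_linear a).

Lemma crdE (m : 'I_n) (x : 'rV[K]_n) : crd m.+1 x = x 0 m.
Proof.
rewrite /crd (bigD1 m) //= eqxx mulr1 big1 ?addr0 // => k km.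
by rewrite eqSS (inj_eq val_inj) (negPf km) mulr0.
Qed.

Lemma crd_out a x : ~~ (0 < a <= n)%N -> crd a x = 0.
Proof.
move=> ha; rewrite /crd big1 // => m _.
by case: eqP => e; rewrite ?mulr0 //; have := ltn_ord m; lia.
Qed.

Lemma crd_basis a b : crd a (E b) = ((a == b) && (0 < a <= n)%N)%:R.
Proof.
have [ha|ha] := boolP (0 < a <= n)%N; last by rewrite crd_out ?andbF.
case: a ha => // a /= an; rewrite (crdE (Ordinal an)) mxE /= andbT //.
Qed.

Lemma crd_inj x y : (forall a, (0 < a <= n)%N -> crd a x = crd a y) -> x = y.
Proof.
move=> h; apply/rowP => m; rewrite -!crdE h //; exact: ltn_ord.
Qed.

Lemma basis_out a : ~~ (0 < a <= n)%N -> E a = 0.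
Proof.
move=> ha; apply: crd_inj => b hb; rewrite crd_basis linear0.
by case: eqP => // e; move: hb; rewrite e (negPf ha).
Qed.

Lemma basis_exp (x : 'rV[K]_n) : x = \sum_(m < n) x 0 m *: E m.+1.
Proof.
apply: crd_inj => a; case: a => // a /= an.
rewrite (crdE (Ordinal an)) linear_sum (bigD1 (Ordinal an)) //=.
rewrite linearZ /= crd_basis eqxx an mulr1 big1 ?addr0 // => k km.
rewrite linearZ /= crd_basis; have /negPf -> : a.+1 != k.+1.
  by rewrite eqSS eq_sym; apply: contraNneq km => e; apply/eqP/val_inj.
by rewrite mulr0.
Qed.

Lemma lie_linear x : linear (br x).
Proof.
move=> c y z; rewrite /fili_lie scaler_sumr -big_split /=; apply: eq_bigr => i _.
rewrite scaler_sumr -big_split /=; apply: eq_bigr => j _.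
by rewrite !mxE scalerA -scalerDl mulrDr mulrCA.
Qed.
HB.instance Definition _ x :=
  GRing.isLinear.Build K 'rV[K]_n 'rV[K]_n *:%R (br x) (lie_linear x).

Lemma lie_anti x y : br x y = - br y x.
Proof.
rewrite /fili_lie exchange_big -sumrN; apply: eq_bigr => i _.
rewrite -sumrN; apply: eq_bigr => j _; rewrite mulrC -scalerN; congr (_ *: _).
rewrite /fili_lie_basis; case: ltngtP => // _; rewrite ?opprK ?oppr0 //.
Qed.

Implicit Types x y z : 'rV[K]_n.

Lemma lieDl x y z : br (x + y) z = br x z + br y z.
Proof. by rewrite lie_anti linearD opprD -!lie_anti. Qed.
Lemma lieNl x z : br (- x) z = - br x z.
Proof. by rewrite lie_anti linearN /= (lie_anti z x) opprK. Qed.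
Lemma lieBl x y z : br (x - y) z = br x z - br y z.
Proof. by rewrite lieDl lieNl. Qed.
Lemma lieZl c x z : br (c *: x) z = c *: br x z.
Proof. by rewrite lie_anti linearZ /= (lie_anti z x) scalerN opprK. Qed.
Lemma lieZr c x z : br x (c *: z) = c *: br x z.
Proof. exact: linearZ. Qed.
Lemma lie0l z : br 0 z = 0.
Proof. by rewrite lie_anti linear0 oppr0. Qed.

Lemma basisE a (m : 'I_n) : E a 0 m = (m.+1 == a)%:R.
Proof. by rewrite mxE. Qed.

Lemma lie_basis i j : (0 < i <= n)%N -> (0 < j <= n)%N ->
  br (E i) (E j) = fili_lie_basis K n i j.
Proof.
case: i => // i /= hi; case: j => // j /= hj.
rewrite /fili_lie.
under eq_bigr => k _ do under eq_bigr => l _ do rewrite !basisE !eqSS.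
move: (fili_lie_basis K n) => F.
rewrite (bigD1 (Ordinal hi)) //= [X in _ + X]big1 ?addr0; last first.
  move=> k ki; apply: big1 => l _.
  by rewrite -[_ == i]/(k == Ordinal hi) (negPf ki) mul0r scale0r.
rewrite (bigD1 (Ordinal hj)) //= !eqxx mul1r scale1r big1 ?addr0 // => l lj.
by rewrite -[_ == j]/(l == Ordinal hj) (negPf lj) mulr0 scale0r.
Qed.

Lemma lie_xx_basis i : br (E i) (E i) = 0.
Proof.
have [hi|hi] := boolP (0 < i <= n)%N; last by rewrite basis_out ?linear0.
by rewrite lie_basis // /fili_lie_basis ltnn.
Qed.

Lemma lie_1 j : (2 <= j)%N -> br (E 1) (E j) = E j.+1.
Proof.
move=> j2; have [jn|jn] := leqP j n; last first.
  by rewrite !(basis_out j, basis_out j.+1) ?linear0 //; lia.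
by rewrite lie_basis /fili_lie_basis; [rewrite j2|lia..].
Qed.

Lemma linear_basis0 (f : {linear 'rV[K]_n -> 'rV[K]_n}) :
  (forall i, (0 < i)%N -> f (E i) = 0) -> forall x, f x = 0.
Proof.
move=> h x; rewrite (basis_exp x) linear_sum big1 // => i _.
by rewrite linearZ /= h ?scaler0.
Qed.

Definition jac x y z := br (br x y) z + br (br y z) x + br (br z x) y.

Lemma jac_cyc x y z : jac x y z = jac y z x.
Proof. by rewrite /jac -addrA addrC. Qed.

Lemma jac_anti x y z : jac x y z = - jac y x z.
Proof.
rewrite /jac (lie_anti y x) (lie_anti x z) (lie_anti z y) !lieNl -!opprD opprK.
by rewrite -!addrA; congr (_ + _); rewrite addrC.
Qed.

Lemma jac_linear x y : linear (jac x y).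
Proof.
move=> c z t; rewrite /jac !linearD !linearZ /= !lieDl !lieZl.
by rewrite (addrACA (c *: br (br x y) z)) (addrACA (_ + _) (_ + br (br y t) x)).
Qed.

(** The Jacobi expression is trilinear, invariant under cyclic permutations and
    alternating on basis vectors, so increasing triples suffice. *)
Lemma jac_basis0 :
  (forall i j k, (0 < i)%N -> (i < j < k)%N -> jac (E i) (E j) (E k) = 0) ->
  forall x y z, jac x y z = 0.
Proof.
have jac_coef2 x y : jac x x y = 0 <-> br (br x x) y = 0.
  rewrite /jac (lie_anti y x) lieNl -addrA addrN addr0 //.
have jacii i x : jac (E i) (E i) x = 0 by apply/jac_coef2; rewrite lie_xx_basis lie0l.
move=> h; have hlt i j k : (0 < i)%N -> (0 < k)%N -> (i < j)%N ->
    jac (E i) (E j) (E k) = 0.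
  move=> i0 k0 ij; have [jk|kj|<-] := ltngtP j k; last by rewrite jac_cyc jacii.
  - by rewrite h // ij.
  have [ik|ki|->] := ltngtP i k; last by rewrite -jac_cyc jacii.
  - by rewrite jac_anti jac_cyc h ?oppr0 // ik.
  by rewrite -jac_cyc h // ki.
have hb i j k : (0 < i)%N -> (0 < j)%N -> (0 < k)%N -> jac (E i) (E j) (E k) = 0.
  move=> i0 j0 k0; have [ij|ji|->] := ltngtP i j; first exact: hlt.
  - by rewrite jac_anti hlt ?oppr0.
  exact: jacii.
have lin0 x y : (forall i, (0 < i)%N -> jac x y (E i) = 0) -> forall z, jac x y z = 0.
  move=> h0; pose f := GRing.isLinear.Build K 'rV[K]_n 'rV[K]_n *:%R
    (jac x y) (jac_linear x y).
  pose F : {linear 'rV[K]_n -> 'rV[K]_n} := HB.pack (jac x y) f.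
  exact: (linear_basis0 F).
have h1 i j : (0 < i)%N -> (0 < j)%N -> forall z, jac (E i) (E j) z = 0.
  by move=> i0 j0; apply: lin0 => k k0; apply: hb.
have h2 i : (0 < i)%N -> forall x z, jac x (E i) z = 0.
  by move=> i0 x; apply: lin0 => j j0; rewrite jac_cyc h1.
by move=> x y; apply: lin0 => i i0; rewrite jac_cyc h2.
Qed.

End Coord.

(** * The Jacobi identity *)

Section Bracket.
Variables (K : fieldType) (charK0 : [pchar K] =i pred0).
Variables (n : nat) (n_ge13 : (13 <= n)%N).
Let d := (n - 11)%N.
Notation E := (fili_basis K n).
Notation br := (fili_lie K n).
Notation w := (witt K).
Notation p := (pert1 K n).
Notation q := (pert2 K n).

Lemma lie_ge2 i j : (2 <= i)%N -> (2 <= j)%N ->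
  br (E i) (E j) = w i j *: E (i + j)%N + p i j *: E (i + j + d)%N
                   + q i j *: E (i + j + 2 * d)%N.
Proof.
wlog ij : i j / (i < j)%N.
  move=> hw i2 j2; have [ij|ji|->] := ltngtP i j; first exact: hw.
    rewrite lie_anti hw // (addnC j) witt_anti pert1_anti pert2_anti.
    by rewrite !scaleNr -!opprD opprK.
  have anti0 (c : K) : c = - c -> c = 0.
    move/eqP; rewrite -subr_eq0 opprK -mulr2n -mulr_natl mulf_eq0 natK_eq0 //=.
    by move/eqP.
  have -> : w j j = 0 by apply/anti0/witt_anti.
  have -> : p j j = 0 by apply/anti0/pert1_anti.
  have -> : q j j = 0 by apply/anti0/pert2_anti.
  by rewrite lie_xx_basis !scale0r !addr0.
move=> i2 j2; have [jn|jn] := leqP j n; last first.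
  by rewrite (basis_out _ _ j) ?linear0 ?[E (_ + _)%N]basis_out ?scaler0 ?addr0 //; lia.
rewrite lie_basis; [|lia..]; rewrite /fili_lie_basis ij /fili_lie_lt.
have /negPf -> : i != 1%N by lia.
apply: crd_inj => a /andP[a0 an].
rewrite !linearD !linearZ /= !crd_basis a0 an !andbT linear_sum.
rewrite (bigD1_seq a) ?iota_uniq ?mem_index_iota ?a0 //=.
rewrite big1 => [|r ra]; last first.
  by rewrite linearZ /= crd_basis eq_sym (negPf ra) mulr0.
rewrite addr0 linearZ /= crd_basis eqxx a0 an mulr1 fili_coefE // ?i2 //.
by rewrite /bracket_coef; congr (_ + _ + _); rewrite mulrC.
Qed.

(** Jacobi identity for triples containing e_1.  The recurrence for the two
    perturbation tables is needed only where the basis vector that they multiply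
    is nonzero. *)
Lemma lie_1_deriv j k : (2 <= j)%N -> (j < k)%N ->
  br (E 1) (br (E j) (E k)) = br (E j.+1) (E k) + br (E j) (E k.+1).
Proof.
move=> j2 jk; rewrite !lie_ge2 //; [|lia..].
rewrite !linearD !linearZ /= !lie_1; [|lia..].
rewrite !addnS !addSn (wittS _ charK0 j k) //; last by lia.
have e1 : p j k.+1 *: E (j + k + d).+1 = (p j k - p j.+1 k) *: E (j + k + d).+1.
  have [h|h] := leqP (j + k) 10; first by rewrite pert1S ?j2.
  by rewrite basis_out ?scaler0 //; lia.
have e2 : q j k.+1 *: E (j + k + 2 * d).+1 = (q j k - q j.+1 k) *: E (j + k + 2 * d).+1.
  have [n13|n13] := eqVneq n 13%N; last by rewrite !pert2_0 ?subr0.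
  have [h|h] := leqP (j + k) 8; first by rewrite pert2S ?j2.
  by rewrite basis_out ?scaler0 //; lia.
rewrite e1 e2 (scalerBl (w j k)) (scalerBl (p j k)) (scalerBl (q j k)).
set x1 := w j k *: _; set x2 := p j k *: _; set x3 := q j k *: _.
set y1 := w _ _ *: _; set y2 := p _ _ *: _; set y3 := q _ _ *: _.
rewrite addrACA (addrACA y1).
by rewrite !(addrC _ (_ - _)) !subrK.
Qed.

(** The contributions of degree d and 2d to [[e_i, e_j], e_k], where d = n - 11. *)
Definition jac_coef1 i j k : K := w i j * p (i + j) k + p i j * w (i + j + d)%N k.
Definition jac_coef2 i j k : K :=
  w i j * q (i + j) k + p i j * p (i + j + d)%N k + q i j * w (i + j + 2 * d)%N k.

(** Three distinct indices >= 2 have sum at least 9, and then degrees 3d and 4d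
    already lie beyond e_n. *)
Lemma lie_lie i j k : (2 <= i)%N -> (2 <= j)%N -> (2 <= k)%N -> (9 <= i + j + k)%N ->
  br (br (E i) (E j)) (E k) =
  (w i j * w (i + j) k) *: E (i + j + k)%N + jac_coef1 i j k *: E (i + j + k + d)%N
  + jac_coef2 i j k *: E (i + j + k + 2 * d)%N.
Proof.
move=> i2 j2 k2 s9; rewrite (lie_ge2 i j) // !lieDl !lieZl !lie_ge2 //; [|lia..].
have -> : (i + j + d + k = i + j + k + d)%N by lia.
have -> : (i + j + 2 * d + k = i + j + k + 2 * d)%N by lia.
have -> : (i + j + k + d + d = i + j + k + 2 * d)%N by lia.
rewrite (basis_out _ _ (i + j + k + d + 2 * d)); last by lia.
rewrite (basis_out _ _ (i + j + k + 2 * d + d)); last by lia.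
rewrite (basis_out _ _ (i + j + k + 2 * d + 2 * d)); last by lia.
rewrite !scaler0 !addr0 /jac_coef1 /jac_coef2.
move: (p i j) (q i j) (p (i + j)%N k) (q (i + j)%N k) (p (i + j + d)%N k).
move: (w i j) (w (i + j)%N k) (w (i + j + d)%N k) (w (i + j + 2 * d)%N k).
move=> w1 w2 w3 w4 p1 q1 p2 q2 p3; rewrite !scalerDr !scalerDl !scalerA -!addrA.
by do 2!congr (_ + _); rewrite addrCA.
Qed.

End Bracket.

Section Jacobi.
Variables (K : fieldType) (charK0 : [pchar K] =i pred0).
Variables (n : nat) (n_ge13 : (13 <= n)%N).
Let d := (n - 11)%N.
Let D : K := d%:R.
Notation w := (witt K).
Notation p := (pert1 K n).
Notation q := (pert2 K n).

Let NE : n%:R = D + 11.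
Proof. by rewrite -natrD; congr _%:R; rewrite /d; lia. Qed.

Let D_neq0 m : D + m.+1%:R != 0. Proof. exact: natD_neq0. Qed.

Let D2 c : D + c.+1%:R + 1 != 0.
Proof. by rewrite -addrA natr1 D_neq0. Qed.
Let D2n c e : D + c.+1%:R + e.+1%:R != 0.
Proof. by rewrite -addrA -natrD D_neq0. Qed.

(** The parameters as rational functions of D = n - 11, with denominators that
    are visibly nonzero in characteristic zero. *)
Lemma pertAE : pertA K n =
  1 / 7 + 10 / 21 * ((D + 4) * (D + 3) / ((D + 7) * (D + 6))).
Proof.
rewrite /pertA NE.
have -> : D + 11 - 4 = D + 7 by ring.
have -> : D + 11 - 5 = D + 6 by ring.
have -> : D + 11 - 7 = D + 4 by ring.
by have -> : D + 11 - 8 = D + 3 by ring.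
Qed.

Lemma pertBE : pertB K n =
  1 / 42
  - (70 * (D + 3)) / (11 * (D + 9) * (D + 8) * (D + 7) * (D + 6))
  + 25 / 99 * (((D + 5) * (D + 4) * (D + 3))
               / ((D + 9) * (D + 8) * (D + 7)))
  + 5 / 66 * (((D + 6) * (D + 5)) / ((D + 9) * (D + 8)))
  - 65 / 1386 * (((D + 4) * (D + 3)) / ((D + 7) * (D + 6))).
Proof.
rewrite /pertB NE.
have -> : D + 11 - 2 = D + 9 by ring.
have -> : D + 11 - 3 = D + 8 by ring.
have -> : D + 11 - 4 = D + 7 by ring.
have -> : D + 11 - 5 = D + 6 by ring.
have -> : D + 11 - 6 = D + 5 by ring.
have -> : D + 11 - 7 = D + 4 by ring.
by have -> : D + 11 - 8 = D + 3 by ring.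
Qed.

Let n0 c : c.+1%:R != 0 :> K. Proof. by rewrite natK_eq0. Qed.

(** The part of degree d of the Jacobi identity is the cocycle condition for
    the perturbation.  Only four triples 2 <= i < j < k satisfy
    i + j + k + d <= n; the values of
    alpha_(4,n-2) and alpha_(5,n) are solutions of the resulting equations. *)
Lemma jac_coef1_sum0 i j k : (2 <= i)%N -> (i < j < k)%N -> (i + j + k <= 11)%N ->
  jac_coef1 K n i j k + jac_coef1 K n j k i + jac_coef1 K n k i j = 0.
Proof.
move=> i2 ijk s.
have : [|| [&& i == 2, j == 3 & k == 4], [&& i == 2, j == 3 & k == 5],
           [&& i == 2, j == 3 & k == 6] | [&& i == 2, j == 4 & k == 5]]%N by lia.
have shift c : (c.+2 + d = (d + c).+2)%N by lia.
case/or4P => /and3P[/eqP -> /eqP -> /eqP ->]; rewrite /jac_coef1 -/d !shift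
  /pert1 /= ?subr0 ?sub0r ?mul0r ?addr0 ?add0r
  !witt_small // !(witt_r2, witt_r3, witt_r4) // ?pertBE pertAE !natrD -/D.
all: by field; rewrite ?D2 ?D2n ?D_neq0 ?n0.
Qed.

(* a common denominator of the parameters for n = 13 *)
Let M : K := 8 * 27 * 7 * 121.
Let M0 : M != 0. Proof. by rewrite /M !mulf_neq0 ?n0. Qed.

(** The part of degree 2d of the Jacobi identity is nonvacuous only for n = 13 and the
    triple (2, 3, 4), where it amounts to this equation.  The fractions are
    brought to the common denominator M by hand, which keeps the numerals in
    the side conditions small. *)
Lemma pertH_13 : n = 13%N -> pertH K n = 10 / 21 * (5 + pertB K n - 6 * pertA K n).
Proof.
move=> n13; have d2 : d = 2%N by rewrite /d n13.
have nz c e : c.+1%:R + e.+1%:R != 0 :> K by rewrite -natrD addSn n0.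
have fr (a b c : K) : b != 0 -> a * M = c * b -> a / b = c / M.
  by move=> b0 e; apply/eqP; rewrite eqr_div // e.
have -> : pertA K n = (43 * 1452) / M.
  rewrite pertAE /D d2 mulf_div (fr 1 7 (24 * 1089)) ?n0 //; last by rewrite /M; ring.
  rewrite (fr (10 * _) _ (300 * 121)); last first.
  - by rewrite /M; ring.
  - by rewrite ?mulf_neq0 ?n0 ?nz.
  by rewrite -mulrDl; congr (_ / _); ring.
have -> : pertB K n = (6 * 2817) / M.
  rewrite pertBE /D d2 !mulf_div (fr 1 42 4356) ?(fr (70 * (2 + 3)) _ 735)
    ?(fr (25 * _) _ 9800) ?(fr (5 * _) _ 7056) ?(fr (65 * _) _ 3575).
  all: rewrite ?mulf_neq0 ?n0 ?nz //.
    by rewrite -!(mulrBl, mulrDl); congr (_ / _); ring.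
  1-5: by rewrite /M; ring.
have -> x y : 5 + x / M - 6 * (y / M) = (5 * M + x - 6 * y) / M.
  by move: M0; move: (M) => m m0; field.
rewrite /pertH n13 eqxx mulf_div; apply/eqP; rewrite eqr_div ?mulf_neq0 ?M0 ?n0 //.
by apply/eqP; rewrite /M; ring.
Qed.

Lemma jac_coef2_sum0 i j k : (2 <= i)%N -> (i < j < k)%N -> (i + j + k + 2 * d <= n)%N ->
  jac_coef2 K n i j k + jac_coef2 K n j k i + jac_coef2 K n k i j = 0.
Proof.
move=> i2 ijk s.
have d2 : d = 2%N by lia.
have n13 : n = 13%N by lia.
have [-> -> ->] : [/\ i = 2, j = 3 & k = 4]%N by split; lia.
rewrite /jac_coef2 -/d d2 /pert1 /pert2 /=
  ?(subr0, sub0r, mul0r, mulr0, addr0, add0r).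
rewrite !witt_small //.
rewrite pertH_13 //; move: (pertA _ _) (pertB _ _) => A B.
by field; rewrite ?n0.
Qed.

Lemma lie_jacobi x y z : jac K n x y z = 0.
Proof.
apply: jac_basis0 => {x y z} i j k i0 /andP[ij jk].
case: i i0 ij => [|[|i]] // _ ij.
  rewrite /jac (lie_1 _ _ j) // (lie_anti _ _ _ (fili_basis K n 1)).
  rewrite (lie_anti _ _ (fili_basis K n k) (fili_basis K n 1)) lie_1; last by lia.
  rewrite lieNl lie_1_deriv // (lie_anti _ _ (fili_basis K n k.+1)) opprK opprD.
  by rewrite addrA addrN sub0r addNr.
rewrite /jac (lie_lie K charK0 n n_ge13 i.+2 j k) //; [|lia..].
rewrite (lie_lie K charK0 n n_ge13 j k i.+2) //; [|lia..].
rewrite (lie_lie K charK0 n n_ge13 k i.+2 j) //; [|lia..].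
have -> : (j + k + i.+2 = i.+2 + j + k)%N by lia.
have -> : (k + i.+2 + j = i.+2 + j + k)%N by lia.
have w0 := witt_jacobi K charK0 i.+2 j k.
have e1 : (jac_coef1 K n i.+2 j k + jac_coef1 K n j k i.+2 + jac_coef1 K n k i.+2 j) *:
   fili_basis K n (i.+2 + j + k + d) = 0.
  have [h|h] := leqP (i.+2 + j + k) 11; first by rewrite jac_coef1_sum0 ?scale0r // ij.
  by rewrite basis_out ?scaler0 //; lia.
have e2 : (jac_coef2 K n i.+2 j k + jac_coef2 K n j k i.+2 + jac_coef2 K n k i.+2 j) *:
   fili_basis K n (i.+2 + j + k + 2 * d) = 0.
  have [h|h] := leqP (i.+2 + j + k + 2 * d) n.
    by rewrite jac_coef2_sum0 ?scale0r // ij.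
  by rewrite basis_out ?scaler0 //; lia.
have comb (V : lmodType K) (a1 b1 c1 a2 b2 c2 a3 b3 c3 : K) (u v t : V) :
    a1 *: u + b1 *: v + c1 *: t + (a2 *: u + b2 *: v + c2 *: t)
    + (a3 *: u + b3 *: v + c3 *: t)
    = (a1 + a2 + a3) *: u + (b1 + b2 + b3) *: v + (c1 + c2 + c3) *: t.
  rewrite !scalerDl (addrACA (_ + _) (c1 *: _)) (addrACA (a1 *: _)).
  by rewrite (addrACA _ (_ + c2 *: _)) (addrACA _ (_ + b2 *: _)).
by rewrite comb w0 ?scale0r ?e1 ?e2 ?addr0 //; lia.
Qed.

End Jacobi.

(** * The weight filtration *)

Section Filtration.
Variables (K : fieldType) (charK0 : [pchar K] =i pred0).
Variables (n : nat) (n_ge13 : (13 <= n)%N).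
Notation E := (fili_basis K n).
Notation br := (fili_lie K n).
Notation V := 'rV[K]_n.
Notation crd := (@crd K n).
Implicit Types x y z v : V.

(** The span of e_a, e_(a+1), ..., e_n. *)
Definition flt (a : nat) (x : V) : Prop := forall t, (t < a)%N -> crd t x = 0.

Lemma flt_basis a b : (a <= b)%N -> flt a (E b).
Proof. by move=> ab t ta; rewrite crd_basis; case: eqP => // e; lia. Qed.

Lemma fltD a x y : flt a x -> flt a y -> flt a (x + y).
Proof. by move=> hx hy t ta; rewrite linearD /= hx ?hy ?addr0. Qed.

Lemma fltZ a c x : flt a x -> flt a (c *: x).
Proof. by move=> hx t ta; rewrite linearZ /= hx ?mulr0. Qed.

Lemma fltN a x : flt a x -> flt a (- x).
Proof. by move=> hx t ta; rewrite linearN /= hx ?oppr0. Qed.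

Lemma fltW a b x : (a <= b)%N -> flt b x -> flt a x.
Proof. by move=> ab hx t ta; apply: hx; apply: leq_trans ab. Qed.

Lemma flt_sum a (I : finType) (F : I -> V) :
  (forall i, flt a (F i)) -> flt a (\sum_i F i).
Proof. by move=> hF t ta; rewrite linear_sum big1 // => i _; apply: hF. Qed.

Lemma flt_top a x : (n < a)%N -> flt a x -> x = 0.
Proof.
by move=> na hx; apply: crd_inj => t /andP[_ tn]; rewrite hx ?linear0 //; lia.
Qed.

Lemma flt_tail a x : flt a x -> (0 < a <= n)%N -> flt a.+1 (x - crd a x *: E a).
Proof.
move=> hx ha t; rewrite ltnS leq_eqVlt => /predU1P[->|ta].
  by rewrite linearB linearZ /= crd_basis eqxx ha mulr1 subrr.
rewrite linearB linearZ /= hx // crd_basis; case: eqP => [e|]; first by lia.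
by rewrite mulr0 subr0.
Qed.

(** The structure constants of the associated graded algebra, a truncated Witt
    algebra. *)
Definition lead (i j : nat) : K :=
  if i == 1%N then (j != 1%N)%:R else if j == 1%N then -1 else witt K i j.

Lemma lie_basis_flt i j : (0 < i)%N -> (0 < j)%N -> flt (i + j) (br (E i) (E j)).
Proof.
case: i => [|[|i]] // _; case: j => [|[|j]] // _.
- by rewrite lie_xx_basis => t _; rewrite linear0.
- by rewrite lie_1 //; apply: flt_basis.
- by rewrite lie_anti lie_1 // addn1; apply/fltN/flt_basis.
rewrite (lie_ge2 K charK0 n n_ge13) //.
by apply: fltD; [apply: fltD|]; apply: fltZ; apply: flt_basis; lia.
Qed.

Lemma lie_basis_lead i j : (0 < i)%N -> (0 < j)%N -> (i + j <= n)%N ->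
  crd (i + j)%N (br (E i) (E j)) = lead i j.
Proof.
case: i => [|[|i]] // _; case: j => [|[|j]] // _ ijn; rewrite /lead /=.
- by rewrite lie_xx_basis linear0.
- by rewrite lie_1 // crd_basis eqxx /= ijn.
- rewrite lie_anti lie_1 // linearN /= crd_basis addn1 eqxx.
  by move: ijn; rewrite addn1 /= => ->.
rewrite (lie_ge2 K charK0 n n_ge13) // !linearD !linearZ /= !crd_basis eqxx.
have -> : (i.+2 + j.+2 == i.+2 + j.+2 + (n - 11))%N = false by lia.
have -> : (i.+2 + j.+2 == i.+2 + j.+2 + 2 * (n - 11))%N = false by lia.
have -> : (0 < i.+2 + j.+2 <= n)%N by lia.
by rewrite !mulr0 mulr1 !addr0.
Qed.

Lemma lie_flt a b x y : flt a x -> flt b y -> flt (a + b) (br x y).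
Proof.
move=> hx hy t tab; rewrite linear_sum big1 // => i _; rewrite linear_sum big1 // => j _.
rewrite -lie_basis ?ltn_ord // linearZ /= -!crdE.
have [ia|ia] := ltnP i.+1 a; first by rewrite hx // !mul0r.
have [jb|jb] := ltnP j.+1 b; first by rewrite hy // mulr0 mul0r.
by rewrite (@lie_basis_flt i.+1 j.+1) ?mulr0 //; lia.
Qed.

(** Leading coefficients multiply as in the associated graded algebra; hence the
    perturbation is invisible in most of the arguments below. *)
Lemma lie_lead a b x y : flt a x -> flt b y -> (0 < a)%N -> (0 < b)%N ->
  (a + b <= n)%N -> crd (a + b)%N (br x y) = lead a b * crd a x * crd b y.
Proof.
move=> hx hy a0 b0 abn.
have hx' := flt_tail a x hx; have hy' := flt_tail b y hy.
have ex := subrK (crd a x *: E a) x; have ey := subrK (crd b y *: E b) y.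
move: (x - _) (y - _) hx' hy' ex ey => x' y' hx' hy' ex ey.
have -> : br x y = br x' y
    + (crd a x *: br (E a) y' + (crd a x * crd b y) *: br (E a) (E b)).
  rewrite -scalerA -scalerDr -linearZ -linearD /= ey -lieZl -lieDl ex //.
rewrite !linearD !linearZ /= lie_basis_lead //.
rewrite (lie_flt a.+1 b x' y) ?addSn //; last by apply: hx'; lia.
rewrite (lie_flt a b.+1 (E a) y') ?addnS //; [|exact: flt_basis|by apply: hy'; lia].
by rewrite mulr0 !add0r mulrC mulrA.
Qed.

Lemma lead_neq0 i j : i != j -> lead i j != 0.
Proof.
rewrite /lead; case: (i =P 1%N) => [->|_].
  by move=> h; rewrite (eq_sym j) h oner_eq0.
case: (j =P 1%N) => _; first by rewrite oppr_eq0 oner_eq0.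
exact: witt_neq0.
Qed.

(** If e_i is the leading vector of x, then [e_(m-i), x] has leading vector e_m
    as soon as m - i differs from i, since only [e_i, e_i] vanishes in the graded
    algebra.  Descending induction on m then solves [y, x] = z. *)
Lemma lie_onto i m x z : (0 < i)%N -> flt i x -> crd i x != 0 ->
  (2 * i < m)%N -> flt m z -> exists y, br y x = z.
Proof.
move=> i0 hx xi0; have [k] := ubnP (n.+1 - m); elim: k => // k IHk in m z *.
move=> mk im hz; have [mn|nm] := leqP m n; last first.
  by exists 0; rewrite lie0l (flt_top _ _ nm hz).
have l0 : lead (m - i) i != 0 by apply: lead_neq0; lia.
pose y := (crd m z / (lead (m - i) i * crd i x)) *: E (m - i)%N.
have hm : (m - i + i = m)%N by lia.
have hy : flt (m - i) y by apply/fltZ/flt_basis.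
have hzy : flt m.+1 (z - br y x).
  move=> t; rewrite ltnS leq_eqVlt linearB => /predU1P[->|tm] /=; last first.
    by rewrite hz // (lie_flt _ _ _ _ hy hx) ?hm // subr0.
  have -> : crd m (br y x) = crd (m - i + i)%N (br y x) by rewrite hm.
  rewrite lie_lead //; [|lia..].
  rewrite linearZ /= crd_basis eqxx; have -> : (0 < m - i <= n)%N by lia.
  by rewrite mulr1 mulrAC [X in _ - X]mulrC divfK ?subrr ?mulf_neq0.
have [||y' hy'] := IHk m.+1 (z - br y x) _ _ hzy; [lia|lia|].
by exists (y' + y); rewrite lieDl hy' subrK.
Qed.

End Filtration.

(** * Derivations *)

Section Derivation.
Variables (K : fieldType) (charK0 : [pchar K] =i pred0).
Variables (n : nat) (n_ge13 : (13 <= n)%N).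
Notation E := (fili_basis K n).
Notation br := (fili_lie K n).
Notation V := 'rV[K]_n.
Notation crd := (@crd K n).
Notation flt := (@flt K n).
Implicit Types (x y z v : V) (D : 'End(V)).

Let n0 c : c.+1%:R != 0 :> K. Proof. by rewrite natK_eq0. Qed.

Lemma ad_derivation y : is_derivation br (linfun (br y)).
Proof.
move=> x z; rewrite !lfunE /=.
have e2 : br (br z y) x = br x (br y z).
  by rewrite lie_anti (lie_anti _ _ z) linearN opprK.
have := lie_jacobi K charK0 n n_ge13 y x z.
rewrite /jac (lie_anti _ _ (br x z)) e2 addrAC.
by move/eqP; rewrite subr_eq0 => /eqP <-.
Qed.

Lemma derivB D1 D2 : is_derivation br D1 -> is_derivation br D2 ->
  is_derivation br (D1 - D2).
Proof.
move=> h1 h2 x y; rewrite !lfunE /= !lfunE /= h1 h2.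
by rewrite lieBl linearB /= opprD addrACA.
Qed.

Lemma lie23 : br (E 2) (E 3) = E 5.
Proof.
rewrite (lie_ge2 K charK0 n n_ge13) // (witt_small K charK0) /pert1 /pert2 /=.
by rewrite subr0 !scale0r !addr0 scale1r.
Qed.

Lemma lie24 : br (E 2) (E 4) = E 6.
Proof.
rewrite (lie_ge2 K charK0 n n_ge13) // (witt_small K charK0) /pert1 /pert2 /=.
by rewrite subr0 !scale0r !addr0 scale1r.
Qed.

Lemma lie34 : br (E 3) (E 4) = (1 / 10) *: E 7 + E (n - 4)%N.
Proof.
rewrite (lie_ge2 K charK0 n n_ge13) // (witt_small K charK0) /pert1 /pert2 /=.
rewrite !subr0 !scale0r !addr0 scale1r; congr (_ + E _); lia.
Qed.

(* A derivation normalised by subtracting an inner one: e_1 is sent to the plane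
   of e_1 and e_2, and no e_3 occurs in the image of e_2. *)
Section Reduced.
Variable D : 'End(V).
Hypothesis derD : is_derivation br D.
Variables (l a b u : K) (v : V).
Hypothesis De1 : D (E 1) = l *: E 1 + a *: E 2.
Hypothesis De2 : D (E 2) = b *: E 1 + u *: E 2 + v.
Hypothesis v4 : flt 4 v.

Let ad1 := br (E 1).

Let flt_ad1 c x : flt c x -> flt c.+1 (ad1 x).
Proof.
by move=> hx; rewrite -add1n; apply: lie_flt => //; apply: flt_basis.
Qed.

Lemma reduced_e3 : D (E 3) = (l + u) *: E 3 + ad1 v.
Proof.
rewrite -(lie_1 K n 2) // derD De1 De2 lieDl !lieZl lie_xx_basis scaler0 addr0.
rewrite !linearD !linearZ /= lie_xx_basis scaler0 add0r lie_1 // addrA -scalerDl //.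
Qed.

Lemma reduced_e4 : D (E 4) = a *: E 5 + (l + (l + u)) *: E 4 + ad1 (ad1 v).
Proof.
rewrite -(lie_1 K n 3) // derD De1 reduced_e3 lieDl !lieZl lie_1 // lie23.
rewrite linearD linearZ /= lie_1 // (addrC (l *: _)) -addrA (addrA (l *: _)).
by rewrite -scalerDl addrA.
Qed.

Lemma reduced_e5 : D (E 5) =
  (l + (l + (l + u))) *: E 5 + (a + a) *: E 6 + ad1 (ad1 (ad1 v)).
Proof.
rewrite -{1}(lie_1 K n 4) // derD De1 reduced_e4 lieDl !lieZl lie_1 // lie24.
rewrite !linearD !linearZ /= !lie_1 // [a *: E 6 + _ *: E 5]addrC.
by rewrite addrA addrACA -!scalerDl.
Qed.

(** Since e_5 = [e_1, e_4] = [e_2, e_3], the image of e_5 can be computed in two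
    ways; nearly all constraints on D come from this. *)
Lemma derivation_relation23 :
  (l + (l + (l + u))) *: E 5 + (a + a) *: E 6 + ad1 (ad1 (ad1 v)) =
  b *: E 4 + (u + (l + u)) *: E 5 + (br v (E 3) + br (E 2) (ad1 v)).
Proof.
rewrite -reduced_e5 -lie23 derD De2 reduced_e3 !lieDl !lieZl lie_1 // lie23.
rewrite linearD linearZ /= lie23.
by rewrite addrACA -(addrA (b *: _)) -scalerDl.
Qed.

Lemma crd_weight7 t x y z : flt 7 x -> flt 7 y -> flt 7 z -> (t < 7)%N ->
  crd t x = 0 /\ crd t (y + z) = 0.
Proof. by move=> hx hy hz ht; rewrite hx // linearD /= hy // hz ?addr0. Qed.

(** The terms involving v live in weights >= 7, so the coefficients of e_4, e_5
    and e_6 in the previous relation only see a, b, l and u. *)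
Lemma derivation_low_terms : [/\ b = 0, a = 0 & u = l + l].
Proof.
have fl : flt 7 (ad1 (ad1 (ad1 v))) by do 3!apply: flt_ad1.
have f1 : flt 7 (br v (E 3)).
  by apply: (lie_flt K charK0 n n_ge13 4 3) => //; apply: flt_basis.
have f2 : flt 7 (br (E 2) (ad1 v)).
  by apply: (lie_flt K charK0 n n_ge13 2 5); [apply: flt_basis|apply: flt_ad1].
have R t : (t < 7)%N -> crd t ((l + (l + (l + u))) *: E 5 + (a + a) *: E 6)
    = crd t (b *: E 4 + (u + (l + u)) *: E 5).
  move=> t7; have := congr1 (crd t) derivation_relation23.
  have [h1 h2] := crd_weight7 t _ _ _ fl f1 f2 t7.
  rewrite (linearD (crd t) (_ + _) (ad1 _)) (linearD (crd t) (_ + _) (_ + _)) /=.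
  by rewrite h1 h2 !addr0.
have E1 t c : (0 < t < 7)%N -> crd t (E c) = (t == c)%:R.
  move=> ht; rewrite crd_basis; have -> : (0 < t <= n)%N by lia.
  by rewrite andbT.
have := R 4 isT; have := R 5 isT; have := R 6 isT.
rewrite !linearD !linearZ /= !E1 //= !mulr0 !mulr1 !addr0 !add0r.
move=> ha hu <-; split => //.
  by apply: (mulIf (n0 1)); rewrite mul0r -ha; ring.
by apply: (addIr (l + u)); rewrite -hu; ring.
Qed.

(** If v has leading term c e_m, comparing the coefficients of e_(m+3) gives
    c = c (witt m 3 + witt 2 (m+1)), hence c = 0.  The argument stops at
    m = n - 2, when e_(m+3) = 0. *)
Lemma derivation_high_terms : flt (n - 2) v.
Proof.
have [b0 a0 ul] := derivation_low_terms.
have R : ad1 (ad1 (ad1 v)) = br v (E 3) + br (E 2) (ad1 v).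
  have := derivation_relation23; rewrite b0 a0 ul scale0r addr0 scale0r addr0 add0r.
  have -> : l + (l + (l + (l + l))) = l + l + (l + (l + l)) by ring.
  by move/addrI.
have step m : (4 <= m <= n - 3)%N -> flt m v -> flt m.+1 v.
  move=> /andP[m4 mn] hm t; rewrite ltnS leq_eqVlt => /predU1P[->|]; last exact: hm.
  have h1 := flt_ad1 _ _ hm; have h2 := flt_ad1 _ _ h1.
  have f2 : flt 2 (E 2) by apply: flt_basis.
  have f1 : flt 1 (E 1) by apply: flt_basis.
  have f3 : flt 3 (E 3) by apply: flt_basis.
  have c1 x c : flt c x -> (2 <= c)%N -> (c.+1 <= n)%N -> crd c.+1 (ad1 x) = crd c x.
    move=> hx c2 cn; rewrite -add1n (lie_lead K charK0 n n_ge13) //; last by lia.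
    rewrite crd_basis /lead /=; have /negPf -> : c != 1%N by lia.
    by rewrite (ltn_trans _ n_ge13) // !mul1r.
  have := congr1 (crd m.+3) R.
  have [m2 m1n m2n m3n] : [/\ 2 <= m, m.+1 <= n, m.+2 <= n & m.+3 <= n]%N.
    by split; lia.
  have m2S : (2 <= m.+1)%N by lia.
  rewrite (c1 _ m.+2) // (c1 _ m.+1) // (c1 _ m) //.
  rewrite linearD /= (_ : m.+3 = m + 3)%N; last by lia.
  rewrite (lie_lead K charK0 n n_ge13 m 3) //; [|lia..].
  rewrite (_ : m + 3 = 2 + m.+1)%N; last by lia.
  rewrite (lie_lead K charK0 n n_ge13 2 m.+1) //; [|lia..].
  rewrite c1 //.
  rewrite !crd_basis /= !(ltn_trans _ n_ge13) //.
  rewrite /lead; have /negPf -> : m != 1%N by lia.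
  have /negPf -> : m.+1 != 1%N by lia.
  rewrite /= !mulr1 => e; apply: (mulfI (witt_shift23_neq0 K charK0 m m4)).
  rewrite mulr0 !mulrBl mul1r {1}e; ring.
have H m : (4 <= m <= n - 2)%N -> flt m v.
  elim: m => // m IHm /andP[m4 mn]; have [h|h] := leqP 4 m.
    by apply: step; [lia|apply: IHm; lia].
  by have -> : m.+1 = 4%N by lia.
by apply: H; lia.
Qed.
End Reduced.

(** The grading derivation e_i |-> i e_i does not survive the perturbation:
    [e_3, e_4] has components e_7 and e_(n-4) of different weights, so 7l and
    (n - 4)l must agree. *)
Lemma derivation_no_grading D l v : is_derivation br D ->
  D (E 1) = l *: E 1 -> D (E 2) = (l + l) *: E 2 + v -> flt (n - 2) v ->
  l = 0.
Proof.
move=> derD De1 De2 hv.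
have De i : (2 <= i)%N ->
    exists2 r, D (E i) = (l *+ i) *: E i + r & flt (n - 4 + i) r.
  elim: i => // i IHi; rewrite ltnS leq_eqVlt => /predU1P[<-|i2].
    by exists v; rewrite ?De2 ?mulr2n // (_ : n - 4 + 2 = n - 2)%N //; lia.
  have [r er hr] := IHi i2; exists (br (E 1) r).
    rewrite -lie_1 // derD De1 er lieZl linearD linearZ /= lie_1 //.
    by rewrite addrA -scalerDl -mulrS.
  by rewrite addnS -add1n; apply: lie_flt => //; apply: flt_basis.
have [r3 e3 h3] := De 3%N isT; have [r4 e4 h4] := De 4%N isT.
have r40 : br (E 3) r4 = 0.
  apply: (flt_top _ _ n_ge13 (3 + (n - 4 + 4))%N); first by lia.
  by apply: lie_flt => //; apply: flt_basis.
have [r7 e7 h7] := De 7%N isT.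
have r70 : r7 = 0 by apply: flt_top h7; lia.
have [|r e h] := De (n - 4)%N; first by lia.
have r0 : r = 0 by apply: flt_top h; lia.
have r34 : br r3 (E 4) = 0.
  apply: (flt_top _ _ n_ge13 (n - 4 + 3 + 4)%N); first by lia.
  by apply: lie_flt => //; apply: flt_basis.
have := derD (E 3) (E 4); rewrite lie34 linearD linearZ /= e3 e4 e7 e.
rewrite r70 r0 !addr0 lieDl r34 addr0 lieZl (linearD (br (E 3))) /= r40 addr0.
rewrite lieZr -scalerDl lie34 scalerDr scalerA.
move/(congr1 (crd (n - 4)%N)); rewrite !linearD !linearZ /= !crd_basis eqxx.
have /negPf -> : (n - 4)%N != 7%N by lia.
have -> : (0 < n - 4 <= n)%N by lia.
rewrite /= !mulr0 !mulr1 !add0r -mulrnDr => /eqP.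
rewrite -subr_eq0 -mulrnBr; last by lia.
by rewrite -mulr_natr mulf_eq0 natK_eq0 // => /orP[/eqP //|]; lia.
Qed.

Lemma weight_raising_flt D c : D (E 1) = 0 ->
  (forall i, (2 <= i)%N -> flt (c + i) (D (E i))) ->
  forall i x, flt i x -> flt (c + i) (D x).
Proof.
move=> De1 h i x hx; rewrite (basis_exp _ _ x) linear_sum; apply: flt_sum => m.
rewrite linearZ /= -crdE.
have [mi|im] := ltnP m.+1 i; first by rewrite hx // scale0r => t _; rewrite linear0.
case: (val m) im => [|k] im; first by rewrite De1 scaler0 => t _; rewrite linear0.
by apply: fltZ; apply: fltW (h k.+2 _) => //; lia.
Qed.

(** Such a D raises weights by n - 4, and [g, x] contains every vector of
    weight > 2i when e_i is the leading vector of x.  For i <= 4 the weight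
    n - 4 + i exceeds 2i; for i >= 5 it exceeds n, so D x = 0. *)
Lemma high_almost_inner D : is_derivation br D -> D (E 1) = 0 -> flt (n - 2) (D (E 2)) ->
  is_almost_inner br D.
Proof.
move=> derD De1 hv.
have De i : (2 <= i)%N -> flt (n - 4 + i) (D (E i)).
  elim: i => // i IHi; rewrite ltnS leq_eqVlt => /predU1P[<-|i2].
    by rewrite (_ : n - 4 + 2 = n - 2)%N //; lia.
  rewrite -lie_1 // derD De1 lie0l add0r addnS -add1n.
  by apply: (lie_flt K charK0 n n_ge13); [apply: flt_basis|exact: IHi].
have Dflt := weight_raising_flt D (n - 4) De1 De.
move=> x; have [->|x0] := eqVneq x 0.
  by exists 0; rewrite linear0 lie0l.
have [i xi0 imin] : exists2 i, crd i x != 0 & flt i x.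
  have ex : exists i, crd i x != 0.
    have [a]  : exists a : 'I_n, x 0 a != 0.
      apply/existsP; apply: contra_neqT x0; rewrite negb_exists => /forallP h.
      by apply/rowP => j; rewrite mxE; apply/eqP; have := h j; rewrite negbK.
    by rewrite -crdE; exists a.+1.
  case: (ex_minnP ex) => i hi imin; exists i => // t ti.
  by apply/eqP; apply: contraTT ti => /imin; rewrite -leqNgt.
have i0 : (0 < i)%N.
  by rewrite lt0n; apply: contraNneq xi0 => ->; rewrite crd_out.
have [i5|i5] := leqP i 4.
  have [|y hy] := lie_onto K charK0 n n_ge13 i (n - 4 + i) x (D x)
    i0 imin xi0 _ (Dflt i x imin).
    lia.
  by exists y.
exists 0; rewrite lie0l; apply: (flt_top _ _ n_ge13 (n - 4 + i)%N); first by lia.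
exact: Dflt.
Qed.

(** The bracket with e_1 reaches every vector of weight >= 3, so an inner
    derivation corrects D e_1; adding a multiple of e_1 to y then adjusts the e_3
    coefficient of D e_2 without changing the bracket with e_1. *)
Lemma derivation_reduction D : exists y l a b u v,
  [/\ (D - linfun (br y))%R (E 1) = l *: E 1 + a *: E 2,
      (D - linfun (br y))%R (E 2) = b *: E 1 + u *: E 2 + v & flt 4 v].
Proof.
have tail x : flt 3 (x - (crd 1 x *: E 1 + crd 2 x *: E 2)).
  case=> [|[|[|t]]] // _; rewrite linearB linearD !linearZ /= !crd_basis.
  - by rewrite crd_out // !mulr0 addr0 subr0.
  - by rewrite (ltn_trans _ n_ge13) //= mulr0 mulr1 addr0 subrr.
  - by rewrite (ltn_trans _ n_ge13) //= mulr0 mulr1 add0r subrr.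
have E11 : crd 1 (E 1) != 0.
  by rewrite crd_basis /= (ltn_trans _ n_ge13) // oner_eq0.
have fE1 : flt 1 (E 1) by apply: flt_basis.
have [y hy] := lie_onto K charK0 n n_ge13 1 3 (E 1) _ isT fE1 E11 isT (tail (D (E 1))).
pose z := D (E 2) - br y (E 2).
pose y' := y + crd 3 z *: E 1.
exists y', (crd 1 (D (E 1))), (crd 2 (D (E 1))), (crd 1 z), (crd 2 z).
exists (z - (crd 1 z *: E 1 + crd 2 z *: E 2) - crd 3 z *: E 3); split.
- rewrite !lfunE /= !lfunE /= lfunE /= /y' lieDl lieZl lie_xx_basis scaler0 addr0 hy.
  by rewrite opprB addrC subrK.
- rewrite !lfunE /= !lfunE /= lfunE /= /y' lieDl lieZl lie_1 // opprD addrA -/z.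
  by rewrite addrA [X in _ = X - _]addrC subrK.
have e3 x : crd 3 (x - (crd 1 x *: E 1 + crd 2 x *: E 2)) = crd 3 x.
  by rewrite linearB linearD !linearZ /= !crd_basis /= !mulr0 addr0 subr0.
by rewrite -[X in X *: E 3]e3; apply: flt_tail => //; lia.
Qed.

Lemma der_almost_inner D : is_derivation br D -> is_almost_inner br D.
Proof.
move=> derD; have [y [l [a [b [u [v [e1 e2 v4]]]]]]] := derivation_reduction D.
have derD' := derivB _ _ derD (ad_derivation y).
have [D' eD] : exists D' : 'End(V), D - linfun (br y) = D' by eexists.
rewrite eD in derD' e1 e2.
have [b0 a0 ul] := derivation_low_terms D' derD' _ _ _ _ _ e1 e2 v4.
have hv := derivation_high_terms D' derD' _ _ _ _ _ e1 e2 v4.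
rewrite a0 scale0r addr0 in e1; rewrite b0 scale0r add0r ul in e2.
have l0 := derivation_no_grading D' l v derD' e1 e2 hv.
rewrite l0 scale0r in e1; rewrite l0 addr0 scale0r add0r in e2.
have ai : is_almost_inner br D' by apply: high_almost_inner => //; rewrite e2.
move=> x; have [t ht] := ai x; exists (t + y); rewrite lieDl -ht -eD.
by rewrite !lfunE /= !lfunE /= lfunE /= subrK.
Qed.
End Derivation.

Theorem proposition4p8 (K : fieldType) (charK0 : [pchar K] =i pred0)
    (n : nat) (n_ge13 : (13 <= n)%N) :
  Der (fili_lie K n) = AID (fili_lie K n).
Proof.
apply/seteqP; split=> D /=; last by case.
by move=> derD; split=> //; apply: der_almost_inner.
Qed.
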